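(* Let $0<u_0<u_1$ with $[u_0,u_1]\subset I$, let $v_0<v_1$, and let $u\in\mathcal{C}^m_{0,1}$ be an extremal connecting $A=(u_0,v_0)$ and $B=(u_1,v_1)$. If $u'(v)<f(u(v))$ at some point $v$, then no smooth extremal in $\mathcal{C}^m_{0,1}$ is a strong local minimizer of $\mathcal{R}$ in the class $\mathcal{C}^m_{0,1}$.
   Context: Let $I\subset\mathbb{R}$ be an open interval and $f:I\to(0,\infty)$ a smooth function. The surface has geodesic coordinates $(u,v)$ with metric $du^2+f(u)^2dv^2$. The resistance functional of a graph $u=u(v)$ is $$\mathcal{R}[u]=\int_{v_0}^{v_1}\frac{f(u)^2}{u'^2+f(u)^2}\,dv .$$ $PC^1$ means continuous and piecewise $C^1$ (finitely many corners), and $$\mathcal{C}^m_{0,1}=\{u\in PC^1([v_0,v_1],\mathbb{R}^+): u'\ge 0,\ u(v_0)=u_0,\ u(v_1)=u_1\}.$$ Extremals are smooth solutions of the Euler–Lagrange equation $(f(u)^2-3u'^2)(f(u)u''-f'(u)u'^2)=0$ of $\mathcal{R}$. A function $u\in\mathcal{C}^m_{0,1}$ is a strong local minimizer in $\mathcal{C}^m_{0,1}$ if there is $\varepsilon>0$ such that $\mathcal{R}[w]\ge\mathcal{R}[u]$ for all $w\in\mathcal{C}^m_{0,1}$ with $\sup|w-u|<\varepsilon$. *)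

(* Defs.v *)
From Stdlib Require Import Reals.
From Coquelicot Require Import Coquelicot.
Local Open Scope R_scope.

(* Functions on a compact interval [a, b] are total functions of which only the
   values on [a, b] matter; derivatives on [a, b], in the sense of D_in, are
   one-sided at a and at b. *)

Definition open_itv (a b : Rbar) (x : R) : Prop := Rbar_lt a x /\ Rbar_lt x b.

Definition closed_itv (a b x : R) : Prop := a <= x <= b.

Definition smooth_open (D : R -> Prop) (f : R -> R) : Prop :=
  forall (n : nat) (x : R), D x -> ex_derive_n f n x.

Definition C1_on (a b : R) (g : R -> R) : Prop :=
  exists dg : R -> R,
    (forall x, closed_itv a b x -> D_in g dg (closed_itv a b) x) /\
    continuous_on (closed_itv a b) dg.

(* The corners are among the points t 1, ..., t (n - 1). *)
Definition PC1 (a b : R) (g : R -> R) : Prop :=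
  continuous_on (closed_itv a b) g /\
  exists (n : nat) (t : nat -> R),
    t 0%nat = a /\ t n = b /\
    forall i, (i < n)%nat -> t i < t (S i) /\ C1_on (t i) (t (S i)) g.

(* The class C^m_{0,1}; the condition u' >= 0 is imposed at the interior points
   where u' exists, and passes to the one-sided derivatives by continuity. *)
Definition admissible (u0 u1 v0 v1 : R) (u : R -> R) : Prop :=
  PC1 v0 v1 u /\
  (forall v, closed_itv v0 v1 v -> 0 < u v) /\
  (forall v, v0 < v < v1 -> ex_derive u v -> 0 <= Derive u v) /\
  u v0 = u0 /\ u v1 = u1.

(* For u piecewise C^1, [Derive u v] is the derivative of u at every v in
   (v0, v1) that is not a corner; its values at the corners and at v0, v1 do
   not affect the integral. *)
Definition resistance (f : R -> R) (v0 v1 : R) (u : R -> R) : R :=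
  RInt (fun v => f (u v) ^ 2 / (Derive u v ^ 2 + f (u v) ^ 2)) v0 v1.

(* U k is the k-th derivative of u on [a, b]. *)
Definition smooth_derivs_on (a b : R) (u : R -> R) (U : nat -> R -> R) : Prop :=
  (forall x, closed_itv a b x -> U 0%nat x = u x) /\
  (forall k x, closed_itv a b x -> D_in (U k) (U (S k)) (closed_itv a b) x).

Definition extremal (f : R -> R) (v0 v1 : R) (u : R -> R) : Prop :=
  exists U : nat -> R -> R,
    smooth_derivs_on v0 v1 u U /\
    forall v, closed_itv v0 v1 v ->
      (f (u v) ^ 2 - 3 * U 1%nat v ^ 2) *
      (f (u v) * U 2%nat v - Derive f (u v) * U 1%nat v ^ 2) = 0.

Definition sup_dist (a b : R) (g h : R -> R) : Rbar :=
  Lub_Rbar (fun y => exists x, closed_itv a b x /\ y = Rabs (g x - h x)).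

Definition strong_local_minimizer
    (f : R -> R) (u0 u1 v0 v1 : R) (u : R -> R) : Prop :=
  admissible u0 u1 v0 v1 u /\
  exists eps : R, 0 < eps /\
    forall w, admissible u0 u1 v0 v1 w ->
      Rbar_lt (sup_dist v0 v1 w u) eps ->
      resistance f v0 v1 w >= resistance f v0 v1 u.

(* Main.v *)
Require Import Defs.
From Stdlib Require Import ZArith Reals Lra Lia Ranalysis5 Rtopology.
From Coquelicot Require Import Coquelicot.
Local Open Scope R_scope.

(** In the coordinate [y] with [dy = du / f(u)] the functional becomes the
    integral of [1 / (1 + y' ^ 2)], whose integrand does not depend on [y].
    Hence extremals are straight lines, of slope [c] say, with constant integrand
    [1 / (1 + c ^ 2)] ([extremal_conformal_slope]). The slope is determined by
    the end points ([conformal_slope_eq]), so one slow point on one extremal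
    makes [0 < c < 1] for all of them.

    The function [1 / (1 + p ^ 2)] is not convex on [p >= 0]: mixing slopes 0
    and 1 in proportions [1 - c] and [c] has the mean slope [c] and the mean
    integrand [1 - c / 2], and
    [1 / (1 + c ^ 2) - (1 - c / 2) = c (1 - c) ^ 2 / (2 (1 + c ^ 2)) > 0].
    A fine zigzag with these two slopes is therefore a monotone competitor,
    uniformly as close to the extremal as desired, whose resistance is smaller
    by an amount independent of the fineness.

    The coordinate [y] need not be introduced: since the extremal [W] itself
    solves [W' = c f(W)], the zigzag is [W] composed with a staircase
    reparametrization of [[v0, v1]] whose slopes are 0 and [1 / c]
    ([staircase_curve]). The lemmas [staircase_curve_admissible],
    [staircase_curve_resistance] and [staircase_curve_near] give its three
    properties. *)

(** * One-sided derivatives *)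

(** Extending the function past the end points by its tangent lines turns
    one-sided derivatives into two-sided ones, so that calculus lemmas about
    [is_derive] become available up to the end points. *)
Lemma D_in_extension (a b : R) (g dg : R -> R) :
  a < b ->
  (forall x, closed_itv a b x -> D_in g dg (closed_itv a b) x) ->
  exists G : R -> R,
    forall x, closed_itv a b x -> G x = g x /\ is_derive G x (dg x).
Proof.
  intros ab Hg.
  exists (fun x => if Rlt_dec x a then g a + dg a * (x - a)
           else if Rlt_dec b x then g b + dg b * (x - b) else g x).
  intros x Hx; pose proof Hx as [Hxa Hxb].
  assert (Gx : (if Rlt_dec x a then g a + dg a * (x - a)
           else if Rlt_dec b x then g b + dg b * (x - b) else g x) = g x).
  { destruct (Rlt_dec x a); [lra|]. destruct (Rlt_dec b x); [lra|]. reflexivity. }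
  split; [exact Gx|].
  apply is_derive_Reals; intros eps Heps.
  destruct (Hg x Hx eps Heps) as [alp [Halp H]].
  (* Within this radius [a, b] can be left only if x is the end point crossed. *)
  assert (Hr : exists r, 0 < r /\ (a < x -> r <= x - a) /\ (x < b -> r <= b - x)).
  { destruct (Rle_lt_or_eq_dec _ _ Hxa), (Rle_lt_or_eq_dec _ _ Hxb); try lra.
    - exists (Rmin (x - a) (b - x)).
      pose proof (Rmin_l (x - a) (b - x)). pose proof (Rmin_r (x - a) (b - x)).
      split; [apply Rmin_glb_lt|]; lra.
    - exists (x - a); lra.
    - exists (b - x); lra. }
  destruct Hr as [r [Hr [Hra Hrb]]].
  assert (Hd : 0 < Rmin alp r) by (apply Rmin_glb_lt; lra).
  exists (mkposreal _ Hd); intros h Hh0 Hh; simpl in Hh.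
  pose proof (Rmin_l alp r). pose proof (Rmin_r alp r).
  rewrite Gx.
  assert (Habs : - r < h < r) by (apply Rabs_def2 in Hh; lra).
  destruct (Rlt_dec (x + h) a) as [Hl|Hl].
  - assert (x = a) as -> by (destruct (Rle_lt_or_eq_dec _ _ Hxa); lra).
    replace ((g a + dg a * (a + h - a) - g a) / h - dg a) with 0 by (field; lra).
    rewrite Rabs_R0; lra.
  - destruct (Rlt_dec b (x + h)) as [Hu|Hu].
    + assert (x = b) as -> by (destruct (Rle_lt_or_eq_dec _ _ Hxb); lra).
      replace ((g b + dg b * (b + h - b) - g b) / h - dg b) with 0 by (field; lra).
      rewrite Rabs_R0; lra.
    + specialize (H (x + h)). simpl in H. unfold Rdist in H.
      replace (x + h - x) with h in H by ring.
      apply H. split; [|lra]. split; [split; lra | lra].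
Qed.

Lemma is_derive_D_in (G g dg : R -> R) (D : R -> Prop) (x : R) :
  D x -> (forall y, D y -> g y = G y) -> is_derive G x (dg x) -> D_in g dg D x.
Proof.
  intros Hx HgG HG eps Heps.
  apply is_derive_Reals in HG.
  destruct (HG eps Heps) as [delta Hdelta].
  exists delta; split; [apply cond_pos|].
  intros y [[HDy Hyx] Hy]; simpl in *. unfold Rdist in *.
  rewrite !HgG by assumption.
  replace (G y) with (G (x + (y - x))) by (f_equal; ring).
  apply Hdelta; [lra | exact Hy].
Qed.

Lemma D_in_unique (a b : R) (g dg1 dg2 : R -> R) (x : R) :
  a < b -> closed_itv a b x ->
  D_in g dg1 (closed_itv a b) x -> D_in g dg2 (closed_itv a b) x ->
  dg1 x = dg2 x.
Proof.
  intros ab [Hxa Hxb] H1 H2.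
  refine (single_limit _ _ _ _ _ _ H1 H2).
  intros alp Halp.
  destruct (Rle_lt_or_eq_dec _ _ Hxb) as [Hb|Hb].
  - exists (x + Rmin (alp / 2) (b - x)).
    assert (0 < Rmin (alp / 2) (b - x)) by (apply Rmin_glb_lt; lra).
    pose proof (Rmin_l (alp / 2) (b - x)). pose proof (Rmin_r (alp / 2) (b - x)).
    unfold D_x, closed_itv, Rdist. repeat split; try lra.
    rewrite Rabs_pos_eq; lra.
  - exists (x - Rmin (alp / 2) (x - a)).
    assert (0 < Rmin (alp / 2) (x - a)) by (apply Rmin_glb_lt; lra).
    pose proof (Rmin_l (alp / 2) (x - a)). pose proof (Rmin_r (alp / 2) (x - a)).
    unfold D_x, closed_itv, Rdist. repeat split; try lra.
    rewrite Rabs_left; lra.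
Qed.

Lemma is_derive_continuity_pt (g : R -> R) (x l : R) :
  is_derive g x l -> continuity_pt g x.
Proof.
  intros H. apply continuity_pt_filterlim.
  apply (ex_derive_continuous (K := R_AbsRing) (V := R_NormedModule)).
  exists l; exact H.
Qed.

Lemma nondecreasing_Derive_nonneg (a b : R) (g : R -> R) (x : R) :
  a < x < b ->
  (forall y z, a <= y -> y <= z -> z <= b -> g y <= g z) ->
  ex_derive g x -> 0 <= Derive g x.
Proof.
  intros Hx Hmon Hex.
  apply Derive_correct, is_derive_Reals in Hex.
  destruct (Rle_lt_dec 0 (Derive g x)) as [|Hneg]; [assumption|exfalso].
  destruct (Hex (- Derive g x)) as [delta Hdelta]; [lra|].
  set (h := Rmin (delta / 2) (b - x)).
  pose proof (cond_pos delta).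
  assert (0 < h) by (apply Rmin_glb_lt; lra).
  pose proof (Rmin_l (delta / 2) (b - x)). pose proof (Rmin_r (delta / 2) (b - x)).
  fold h in H1, H2.
  assert (Hq := Hdelta h ltac:(lra) ltac:(rewrite Rabs_pos_eq; lra)).
  assert (Hg := Hmon x (x + h) ltac:(lra) ltac:(lra) ltac:(lra)).
  assert (0 <= (g (x + h) - g x) / h)
    by (apply Rdiv_le_0_compat; lra).
  apply Rabs_def2 in Hq; lra.
Qed.

Lemma derive_nonneg_nondecreasing (a b : R) (g dg : R -> R) :
  (forall x, a <= x <= b -> is_derive g x (dg x)) ->
  (forall x, a < x < b -> 0 <= dg x) ->
  forall y z, a <= y -> y <= z -> z <= b -> g y <= g z.
Proof.
  intros Hd Hpos y z Hay Hyz Hzb.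
  destruct (Rle_lt_or_eq_dec _ _ Hyz) as [Hlt| ->]; [|lra].
  (* [MVT_gen] only locates its point in the closed interval, so the
     derivative is replaced by its absolute value, which agrees inside. *)
  destruct (MVT_gen g y z (fun x => Rabs (dg x))) as [c [_ Hc]].
  - rewrite Rmin_left, Rmax_right by lra. intros x Hx.
    rewrite Rabs_pos_eq by (apply Hpos; lra). apply Hd; lra.
  - rewrite Rmin_left, Rmax_right by lra. intros x Hx.
    apply is_derive_continuity_pt with (dg x), Hd; lra.
  - pose proof (Rmult_le_pos _ (z - y) (Rabs_pos (dg c))). lra.
Qed.

(** * Extremals *)

(** By the intermediate value theorem a non-constant [q] would take two further
    values between two distinct ones, but the cubic [p - p ^ 3] takes no value
    four times. *)
Lemma cubic_level_eq_endpoints (a b : R) (q : R -> R) :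
  a < b ->
  (forall x, a <= x <= b -> continuity_pt q x) ->
  (forall x, a <= x <= b -> q x - q x ^ 3 = q a - q a ^ 3) ->
  q a = q b.
Proof.
  intros ab Hcont Hlev.
  assert (key : forall p : R -> R,
    (forall x, a <= x <= b -> continuity_pt p x) ->
    (forall x, a <= x <= b -> p x - p x ^ 3 = p a - p a ^ 3) -> ~ p a < p b).
  { intros p Hc Hl Hlt.
    assert (ivt : forall m, p a < m < p b -> m - m ^ 3 = p a - p a ^ 3).
    { intros m Hm.
      destruct (IVT_interv (fun x => p x - m) a b) as [z [Hz Hpz]]; try lra.
      - intros x Hx. apply continuity_pt_minus; [apply Hc; lra|].
        apply continuity_pt_const. intros ? ?; reflexivity.
      - rewrite <- (Hl z Hz). replace (p z) with m by lra. reflexivity. }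
    assert (Hb := Hl b ltac:(lra)).
    assert (H1 := ivt ((2 * p a + p b) / 3) ltac:(lra)).
    assert (H2 := ivt ((p a + 2 * p b) / 3) ltac:(lra)).
    set (d := (p b - p a) / 3) in *.
    assert (0 < d) by (unfold d; lra).
    replace (p b) with (p a + 3 * d) in * by (unfold d; lra).
    replace ((2 * p a + (p a + 3 * d)) / 3) with (p a + d) in H1 by lra.
    replace ((p a + 2 * (p a + 3 * d)) / 3) with (p a + 2 * d) in H2 by lra.
    (* The third finite difference of [p - p ^ 3] with step d is - 6 d ^ 3. *)
    assert (6 * d ^ 3 = 0) by (ring_simplify in Hb; ring_simplify in H1;
      ring_simplify in H2; ring_simplify; lra).
    assert (0 < d ^ 3) by (apply pow_lt; lra). lra. }
  apply Rle_antisym; apply Rnot_lt_le.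
  - intros Hlt. apply (key (fun x => - q x)).
    + intros x Hx. apply continuity_pt_opp, Hcont, Hx.
    + intros x Hx. pose proof (Hlev x Hx). simpl in *. lra.
    + lra.
  - apply key; assumption.
Qed.

(** With [q = u' / f(u)] the Euler-Lagrange equation says
    [(1 - 3 q ^ 2) q' = 0], that is, [q - q ^ 3] is constant; by continuity so
    is [q], whichever of the two factors vanishes where. *)
Lemma extremal_conformal_slope (f : R -> R) (u0 u1 v0 v1 : R) (u : R -> R) :
  u0 < u1 -> v0 < v1 ->
  (forall x, closed_itv u0 u1 x -> 0 < f x /\ ex_derive f x) ->
  admissible u0 u1 v0 v1 u -> extremal f v0 v1 u ->
  exists (W : R -> R) (c : R),
    0 < c /\
    (forall v, closed_itv v0 v1 v ->
      W v = u v /\ u0 <= u v <= u1 /\ is_derive W v (c * f (u v)) /\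
      D_in u (fun t => c * f (u t)) (closed_itv v0 v1) v).
Proof.
  intros u01 v01 Hf [_ [_ [Hmon [Hu0 Hu1]]]] [U [[HU0 HU] Hext]].
  destruct (D_in_extension v0 v1 (U 0%nat) (U 1%nat) v01 (HU 0%nat)) as [W HW].
  destruct (D_in_extension v0 v1 (U 1%nat) (U 2%nat) v01 (HU 1%nat)) as [V HV].
  assert (Wu : forall v, closed_itv v0 v1 v -> W v = u v).
  { intros v Hv. destruct (HW v Hv) as [-> _]. apply HU0, Hv. }
  assert (DW : forall v, closed_itv v0 v1 v -> is_derive W v (V v)).
  { intros v Hv. destruct (HV v Hv) as [-> _]. apply HW, Hv. }
  assert (Vpos : forall v, v0 < v < v1 -> 0 <= V v).
  { intros v Hv.
    assert (D : is_derive u v (V v)).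
    { apply (is_derive_ext_loc W); [|apply DW; unfold closed_itv; lra].
      apply filter_imp with (fun t => v0 < t /\ t < v1).
      - intros t Ht. apply Wu. unfold closed_itv; lra.
      - apply (open_and _ _ (open_gt v0) (open_lt v1)). exact Hv. }
    rewrite <- (is_derive_unique _ _ _ D). apply Hmon; [exact Hv|].
    exists (V v); exact D. }
  assert (range : forall v, closed_itv v0 v1 v -> closed_itv u0 u1 (W v)).
  { intros v [Hv0 Hv1].
    pose proof (derive_nonneg_nondecreasing v0 v1 W V DW Vpos) as Hinc.
    pose proof (Hinc v0 v). pose proof (Hinc v v1).
    rewrite (Wu v0), Hu0 in H by (unfold closed_itv; lra).
    rewrite (Wu v1), Hu1 in H0 by (unfold closed_itv; lra).
    split; lra. }
  set (q := fun v => V v / f (W v)).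
  assert (fpos : forall v, closed_itv v0 v1 v -> 0 < f (W v))
    by (intros v Hv; apply Hf, range, Hv).
  assert (Dq : forall v, closed_itv v0 v1 v -> is_derive q v
     ((U 2%nat v * f (W v) - Derive f (W v) * V v ^ 2) / f (W v) ^ 2)).
  { intros v Hv. unfold q. pose proof (fpos v Hv).
    destruct (Hf (W v) (range v Hv)) as [_ Df].
    assert (DfW : is_derive (fun t => f (W t)) v (V v * Derive f (W v))).
    { apply (is_derive_comp f W); [apply Derive_correct, Df | apply DW, Hv]. }
    evar_last.
    - apply (is_derive_div V (fun t => f (W t))); [apply HV, Hv | exact DfW | lra].
    - field. lra. }
  assert (qlev : forall v, closed_itv v0 v1 v ->
     is_derive (fun t => q t - q t ^ 3) v 0).
  { intros v Hv. pose proof (fpos v Hv). pose proof (Dq v Hv) as D.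
    evar_last.
    - apply (is_derive_minus q (fun t => q t ^ 3)); [exact D|].
      apply (is_derive_pow q 3 v), D.
    - pose proof (Hext v Hv) as E.
      rewrite <- (Wu v Hv) in E. destruct (HV v Hv) as [HVv _]. rewrite <- HVv in E.
      unfold minus, plus, opp; simpl. unfold q.
      transitivity ((f (W v) ^ 2 - 3 * V v ^ 2) *
        (f (W v) * U 2%nat v - Derive f (W v) * V v ^ 2) / f (W v) ^ 4).
      + field. lra.
      + rewrite E. unfold Rdiv. ring. }
  assert (qconst : forall v, closed_itv v0 v1 v -> q v = q v0).
  { intros v [Hv0 Hv1].
    destruct (Rle_lt_or_eq_dec _ _ Hv0) as [Hlt| <-]; [|reflexivity].
    symmetry. apply cubic_level_eq_endpoints; [exact Hlt| |].
    - intros x Hx. eapply is_derive_continuity_pt, Dq. unfold closed_itv; lra.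
    - intros x [Hx0 Hx1].
      destruct (Rle_lt_or_eq_dec _ _ Hx0) as [Hlt'| <-]; [|reflexivity].
      symmetry.
      apply (eq_is_derive (fun t => q t - q t ^ 3) v0 x); [|exact Hlt'].
      intros t Ht. apply qlev. unfold closed_itv; lra. }
  assert (Vc : forall v, closed_itv v0 v1 v -> V v = q v0 * f (u v)).
  { intros v Hv. rewrite <- (qconst v Hv), <- (Wu v Hv). unfold q.
    pose proof (fpos v Hv). field. lra. }
  exists W, (q v0). split.
  - destruct (MVT_gen W v0 v1 V) as [x [Hx Hmvt]];
      rewrite ?Rmin_left, ?Rmax_right in * by lra.
    + intros x Hx. apply DW. unfold closed_itv; lra.
    + intros x Hx. eapply is_derive_continuity_pt, DW. unfold closed_itv; lra.
    + rewrite !Wu, Hu0, Hu1, Vc in Hmvt by (unfold closed_itv; lra).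
      pose proof (fpos x Hx). rewrite (Wu x Hx) in H.
      apply Rnot_le_lt. intros Hneg.
      pose proof (Rmult_le_compat_r (f (u x) * (v1 - v0)) _ _
        ltac:(apply Rmult_le_pos; lra) Hneg). lra.
  - intros v Hv.
    assert (HD : is_derive W v (q v0 * f (u v))) by (rewrite <- Vc by exact Hv; apply DW, Hv).
    split; [apply Wu, Hv|]. split; [rewrite <- Wu by exact Hv; apply range, Hv|].
    split; [exact HD|].
    apply (is_derive_D_in W u (fun t => q v0 * f (u t))); [exact Hv| |exact HD].
    intros y Hy. symmetry. apply Wu, Hy.
Qed.

(** In the coordinate [y] with [dy = du / f(u)] such a curve is a straight line
    of slope [c]. Differentiability of [f] along it gives the continuity that
    integration and smoothness of compositions need. *)
Definition constant_slope (f : R -> R) (c v0 v1 : R) (W : R -> R) : Prop :=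
  forall v, closed_itv v0 v1 v ->
    0 < f (W v) /\ ex_derive f (W v) /\ is_derive W v (c * f (W v)).

(** Integrating [u' / f(u) = c] determines [c] from the end points alone, so all
    extremals joining two given points share it. *)
Lemma conformal_slope_eq (f W : R -> R) (c v0 v1 : R) :
  v0 < v1 ->
  constant_slope f c v0 v1 W ->
  c * (v1 - v0) = RInt (fun x => / f x) (W v0) (W v1).
Proof.
  intros v01 H.
  assert (Hc : forall v, closed_itv v0 v1 v -> continuous f (W v)).
  { intros v Hv. apply (ex_derive_continuous (K := R_AbsRing) (V := R_NormedModule)).
    apply H, Hv. }
  assert (fWc : forall v, closed_itv v0 v1 v -> continuous (fun t => f (W t)) v).
  { intros v Hv. apply (continuous_comp W f); [|apply Hc, Hv].
    apply (ex_derive_continuous (K := R_AbsRing) (V := R_NormedModule)).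
    exists (c * f (W v)). apply H, Hv. }
  rewrite <- (RInt_comp (fun x => / f x) W (fun v => c * f (W v)) v0 v1);
    rewrite ?Rmin_left, ?Rmax_right by lra.
  - rewrite (RInt_ext _ (fun _ => c)).
    + rewrite RInt_const. unfold scal; simpl; unfold mult; simpl. ring.
    + rewrite Rmin_left, Rmax_right by lra. intros v Hv.
      unfold scal; simpl; unfold mult; simpl. field.
      apply Rgt_not_eq, H. unfold closed_itv; lra.
  - intros v Hv. apply continuous_Rinv_comp; [apply Hc, Hv|].
    apply Rgt_not_eq, H, Hv.
  - intros v Hv. split; [apply H, Hv|].
    apply (continuous_scal_r c (fun t => f (W t))), fWc, Hv.
Qed.

(** * The staircase *)

(** On each [k, k + 1] this is constant up to [k + 1 - c] and then climbs with
    slope [1 / c], so it meets the diagonal at every integer. *)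
Definition stair (c t : R) : R :=
  let k := IZR (Int_part t) in k + Rmax 0 (1 - (k + 1 - t) / c).

(** The formula of a cell is also right at its end point, which [Int_part]
    attributes to the next cell. *)
Lemma stair_cell (c t : R) (k : Z) :
  0 < c < 1 -> IZR k <= t <= IZR k + 1 ->
  stair c t = IZR k + Rmax 0 (1 - (IZR k + 1 - t) / c).
Proof.
  intros Hc [Hk Hk1]. unfold stair.
  destruct (Rle_lt_or_eq_dec _ _ Hk1) as [Hlt| ->].
  - rewrite <- (Int_part_spec t k) by lra. reflexivity.
  - rewrite <- (Int_part_spec (IZR k + 1) (k + 1)) by (rewrite plus_IZR; lra).
    rewrite plus_IZR.
    replace (1 - (IZR k + 1 + 1 - (IZR k + 1)) / c) with (1 - / c) by (field; lra).
    replace (1 - (IZR k + 1 - (IZR k + 1)) / c) with 1 by (field; lra).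
    assert (/ 1 < / c) by (apply Rinv_lt_contravar; lra). rewrite Rinv_1 in H.
    rewrite Rmax_left, Rmax_right by lra. ring.
Qed.

Lemma stair_flat (c t : R) (k : Z) :
  0 < c < 1 -> IZR k <= t <= IZR k + 1 - c -> stair c t = IZR k.
Proof.
  intros Hc Ht. rewrite (stair_cell c t k) by lra.
  assert (1 <= (IZR k + 1 - t) / c) by (apply Rle_div_r; lra).
  rewrite Rmax_left by lra. ring.
Qed.

Lemma stair_rising (c t : R) (k : Z) :
  0 < c < 1 -> IZR k + 1 - c <= t <= IZR k + 1 ->
  stair c t = IZR k + 1 - (IZR k + 1) / c + / c * t.
Proof.
  intros Hc Ht. rewrite (stair_cell c t k) by lra.
  assert ((IZR k + 1 - t) / c <= 1) by (apply Rle_div_l; lra).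
  rewrite Rmax_right by lra. field. lra.
Qed.

Lemma stair_IZR (c : R) (k : Z) : 0 < c < 1 -> stair c (IZR k) = IZR k.
Proof. intros Hc. apply stair_flat; lra. Qed.

Lemma stair_increment (c x y : R) :
  0 < c < 1 -> x <= y -> 0 <= stair c y - stair c x <= (y - x) / c.
Proof.
  intros Hc Hxy.
  assert (Hcell : forall (k : Z) s t, IZR k <= s -> s <= t -> t <= IZR k + 1 ->
    0 <= stair c t - stair c s <= (t - s) / c).
  { intros k s t Hs Hst Ht. rewrite !(stair_cell c _ k) by lra.
    assert (0 <= (t - s) / c) by (apply Rdiv_le_0_compat; lra).
    replace (1 - (IZR k + 1 - t) / c)
      with (1 - (IZR k + 1 - s) / c + (t - s) / c) by (field; lra).
    unfold Rmax; repeat destruct Rle_dec; lra. }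
  destruct (base_Int_part x) as [Hx1 Hx2]. destruct (base_Int_part y) as [Hy1 Hy2].
  set (i := Int_part x) in *; set (j := Int_part y) in *.
  destruct (Z_lt_ge_dec i j) as [Hij|Hji].
  - (* The integers i + 1 and j between x and y are fixed by the staircase. *)
    assert (Hij' : IZR i + 1 <= IZR j) by (rewrite <- plus_IZR; apply IZR_le; lia).
    pose proof (Hcell i x (IZR (i + 1)) ltac:(lra)) as H1.
    pose proof (Hcell j (IZR j) y ltac:(lra)) as H2.
    rewrite stair_IZR, plus_IZR in H1 by exact Hc.
    rewrite stair_IZR in H2 by exact Hc.
    specialize (H1 ltac:(lra) ltac:(lra)). specialize (H2 ltac:(lra) ltac:(lra)).
    assert (IZR j - (IZR i + 1) <= (IZR j - (IZR i + 1)) / c).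
    { apply Rle_div_r; [lra|].
      pose proof (Rmult_le_compat_l (IZR j - (IZR i + 1)) c 1). lra. }
    replace ((y - x) / c) with ((IZR i + 1 - x) / c + (IZR j - (IZR i + 1)) / c
      + (y - IZR j) / c) by (field; lra).
    lra.
  - apply (Hcell i); try lra. assert (Hji' : IZR j <= IZR i) by (apply IZR_le; lia). lra.
Qed.

Lemma stair_near (c t : R) : 0 < c < 1 -> Rabs (stair c t - t) <= 1.
Proof.
  intros Hc. destruct (base_Int_part t) as [H1 H2].
  set (k := Int_part t) in *.
  pose proof (stair_increment c (IZR k) t Hc ltac:(lra)) as Hl.
  pose proof (stair_increment c t (IZR (k + 1)) Hc ltac:(rewrite plus_IZR; lra)) as Hu.
  rewrite stair_IZR in Hl, Hu by exact Hc. rewrite plus_IZR in Hu.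
  apply Rabs_le. lra.
Qed.

Lemma stair_continuity_pt (c t : R) : 0 < c < 1 -> continuity_pt (stair c) t.
Proof.
  intros Hc eps Heps. exists (eps * c).
  split; [apply Rmult_lt_0_compat; lra|].
  intros x [_ Hx]; simpl in *. unfold Rdist in *.
  apply Rle_lt_trans with (Rabs (x - t) / c); [|apply Rlt_div_l; lra].
  destruct (Rle_lt_dec t x) as [Hle|Hlt].
  - pose proof (stair_increment c t x Hc Hle). rewrite !Rabs_pos_eq; lra.
  - pose proof (stair_increment c x t Hc ltac:(lra)).
    rewrite (Rabs_minus_sym x t), (Rabs_minus_sym (stair c x)), !Rabs_pos_eq; lra.
Qed.

(** The corners of [stair c], numbered so that a step starts at an even knot and
    a climb at an odd one. *)
Definition knot (c : R) (j : nat) : R :=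
  INR (Nat.div2 j) + (if Nat.odd j then 1 - c else 0).

Lemma knot_even (c : R) (i : nat) : knot c (2 * i) = INR i.
Proof. 
  unfold knot. rewrite Nat.div2_double, Nat.odd_mul. simpl. ring.
Qed.

Lemma knot_odd (c : R) (i : nat) : knot c (S (2 * i)) = INR i + 1 - c.
Proof.
  unfold knot. rewrite Nat.div2_succ_double, Nat.odd_succ, Nat.even_mul. simpl. ring.
Qed.

Lemma stair_affine_between_knots (c : R) (j : nat) :
  0 < c < 1 ->
  knot c j < knot c (S j) /\
  exists al be, forall t, knot c j <= t <= knot c (S j) -> stair c t = al + be * t.
Proof.
  intros Hc. destruct (Nat.Even_or_Odd j) as [[i ->]|[i ->]].
  - rewrite knot_even, knot_odd. split; [lra|].
    exists (INR i), 0. intros t Ht. rewrite INR_IZR_INZ in *.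
    rewrite (stair_flat c t (Z.of_nat i)); lra.
  - replace (2 * i + 1)%nat with (S (2 * i)) by lia.
    replace (S (S (2 * i))) with (2 * S i)%nat by lia.
    rewrite knot_even, knot_odd, S_INR. split; [lra|].
    exists (INR i + 1 - (INR i + 1) / c), (/ c). intros t Ht.
    rewrite INR_IZR_INZ in *. apply stair_rising; lra.
Qed.

(** * The competitor *)

Lemma is_RInt_affine_reparam (f W z : R -> R) (c al be s t : R) :
  s <= t ->
  (forall v, s < v < t -> z v = W (al + be * v) /\ 0 < f (W (al + be * v)) /\
     is_derive W (al + be * v) (c * f (W (al + be * v)))) ->
  is_RInt (fun v => f (z v) ^ 2 / (Derive z v ^ 2 + f (z v) ^ 2)) s t
    ((t - s) / (1 + (c * be) ^ 2)).
Proof.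
  intros st H.
  apply (is_RInt_ext (fun _ => / (1 + (c * be) ^ 2))).
  - rewrite Rmin_left, Rmax_right by lra. intros v Hv.
    destruct (H v Hv) as [Hz [Hf HW]].
    assert (D : is_derive z v (be * (c * f (W (al + be * v))))).
    { apply (is_derive_ext_loc (fun y => W (al + be * y))).
      - apply filter_imp with (fun y => s < y /\ y < t).
        + intros y Hy. symmetry. apply H, Hy.
        + apply (open_and _ _ (open_gt s) (open_lt t)). exact Hv.
      - apply (is_derive_comp W (fun y => al + be * y)); [exact HW|].
        auto_derive; [exact I|ring]. }
    rewrite (is_derive_unique _ _ _ D), Hz.
    set (p := f (W (al + be * v))) in *.
    replace ((be * (c * p)) ^ 2 + p ^ 2) with (p ^ 2 * (1 + (c * be) ^ 2)) by ring.
    pose proof (pow2_ge_0 (c * be)).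
    change (/ (1 + (c * be) ^ 2) = p ^ 2 / (p ^ 2 * (1 + (c * be) ^ 2))).
    field. split; lra.
  - apply (is_RInt_const s t (/ (1 + (c * be) ^ 2))).
Qed.

(** A curve of constant slope [c], re-run along a staircase with [n] cells: its
    slope [z' / f(z)] is alternately 0 and [c * (1 / c) = 1]. *)
Definition staircase_curve (c : R) (W : R -> R) (v0 v1 : R) (n : nat) (v : R) : R :=
  let h := (v1 - v0) / INR n in W (v0 + h * stair c ((v - v0) / h)).

Lemma staircase_param_range (c v0 h : R) (n : nat) (v : R) :
  0 < c < 1 -> 0 < h -> v0 <= v <= v0 + INR n * h ->
  v0 <= v0 + h * stair c ((v - v0) / h) <= v0 + INR n * h.
Proof.
  intros Hc Hh Hv.
  assert (H0 : 0 <= (v - v0) / h) by (apply Rdiv_le_0_compat; lra).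
  assert (H1 : (v - v0) / h <= INR n) by (apply Rle_div_l; lra).
  pose proof (stair_increment c _ _ Hc H0) as [A _].
  pose proof (stair_increment c _ _ Hc H1) as [B _].
  rewrite stair_IZR in A by exact Hc.
  rewrite INR_IZR_INZ, stair_IZR, <- INR_IZR_INZ in B by exact Hc.
  pose proof (Rmult_le_compat_l h 0 (stair c ((v - v0) / h))).
  pose proof (Rmult_le_compat_l h (stair c ((v - v0) / h)) (INR n)). lra.
Qed.

(** Each cell, of length [h], contributes [(1 - c) h] from its flat part and
    [c h / 2] from its part of slope 1, where the integrand is 1/2. *)
Lemma staircase_curve_resistance (f W : R -> R) (c v0 v1 : R) (n : nat) :
  v0 < v1 -> 0 < c < 1 -> (0 < n)%nat ->
  constant_slope f c v0 v1 W ->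
  resistance f v0 v1 (staircase_curve c W v0 v1 n) = (v1 - v0) * (1 - c / 2).
Proof.
  intros v01 Hc Hn HW. apply lt_0_INR in Hn.
  unfold resistance, staircase_curve. set (h := (v1 - v0) / INR n).
  set (z := fun v => W (v0 + h * stair c ((v - v0) / h))).
  assert (Hh : 0 < h) by (apply Rdiv_lt_0_compat; lra).
  assert (Hnh : v0 + INR n * h = v1) by (unfold h; field; lra).
  assert (cells : forall i : nat, (i <= n)%nat ->
    is_RInt (fun v => f (z v) ^ 2 / (Derive z v ^ 2 + f (z v) ^ 2))
      v0 (v0 + INR i * h) (INR i * h * (1 - c / 2))).
  { induction i as [|i IH]; intros Hi.
    - replace (v0 + INR 0 * h) with v0 by (simpl; ring).
      replace (INR 0 * h * (1 - c / 2)) with 0 by (simpl; ring).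
      apply (is_RInt_point (V := R_NormedModule)).
    - assert (Hin : INR (S i) * h <= INR n * h)
        by (apply Rmult_le_compat_r; [lra|apply le_INR, Hi]).
      pose proof (Rmult_le_pos _ h (pos_INR i) ltac:(lra)) as Hi0.
      rewrite S_INR in *.
      assert (Hmid : 0 < h * (1 - c) < h).
      { split; [apply Rmult_lt_0_compat; lra|].
        pose proof (Rmult_lt_0_compat h c). lra. }
      assert (piece : forall al be s t, s <= t ->
        v0 <= s -> t <= v0 + (INR i + 1) * h ->
        (forall v, s < v < t -> v0 + h * stair c ((v - v0) / h) = al + be * v) ->
        is_RInt (fun v => f (z v) ^ 2 / (Derive z v ^ 2 + f (z v) ^ 2)) s t
          ((t - s) / (1 + (c * be) ^ 2))).
      { intros al be s t Hst Hs Ht Haff.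
        apply (is_RInt_affine_reparam f W z c al be); [exact Hst|].
        intros v Hv. unfold z. rewrite <- Haff by exact Hv.
        destruct (HW (v0 + h * stair c ((v - v0) / h))) as [P [_ D]].
        - unfold closed_itv. rewrite <- Hnh.
          apply staircase_param_range; [exact Hc|exact Hh|lra].
        - split; [reflexivity|]. split; [exact P|exact D]. }
      replace ((INR i + 1) * h * (1 - c / 2)) with
        (INR i * h * (1 - c / 2) + (h * (1 - c) + h * c / 2)) by field.
      apply (is_RInt_Chasles (V := R_NormedModule) _ _ (v0 + INR i * h)); [apply IH; lia|].
      apply (is_RInt_Chasles (V := R_NormedModule) _ _ (v0 + INR i * h + h * (1 - c))).
      + replace (h * (1 - c)) with
          ((v0 + INR i * h + h * (1 - c) - (v0 + INR i * h)) / (1 + (c * 0) ^ 2))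
          at 2 by field.
        apply (piece (v0 + h * INR i)); try lra.
        intros v Hv. rewrite (stair_flat c _ (Z.of_nat i)); rewrite <- ?INR_IZR_INZ;
          [ring|exact Hc|].
        split; [apply Rle_div_r|apply Rle_div_l]; lra.
      + replace (h * c / 2) with
          ((v0 + (INR i + 1) * h - (v0 + INR i * h + h * (1 - c))) / (1 + (c * / c) ^ 2))
          by (rewrite Rinv_r by lra; field).
        apply (piece (v0 + h * (INR i + 1 - (INR i + 1) / c) - v0 / c)); try lra.
        intros v Hv. rewrite (stair_rising c _ (Z.of_nat i)); rewrite <- ?INR_IZR_INZ;
          [field; lra|exact Hc|].
        split; [apply Rle_div_r|apply Rle_div_l]; lra. }
  apply is_RInt_unique.
  replace ((v1 - v0) * (1 - c / 2)) with (INR n * h * (1 - c / 2))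
    by (rewrite <- Hnh; ring).
  specialize (cells n (le_n n)). rewrite Hnh in cells. exact cells.
Qed.

Lemma staircase_curve_admissible (f W : R -> R) (c v0 v1 : R) (n : nat) :
  v0 < v1 -> 0 < c < 1 -> (0 < n)%nat ->
  (forall v, closed_itv v0 v1 v -> 0 < W v) ->
  constant_slope f c v0 v1 W ->
  admissible (W v0) (W v1) v0 v1 (staircase_curve c W v0 v1 n).
Proof.
  intros v01 Hc Hn Wpos HW. apply lt_0_INR in Hn.
  unfold staircase_curve. set (h := (v1 - v0) / INR n).
  set (s := fun v => v0 + h * stair c ((v - v0) / h)).
  change (fun v => W (v0 + h * stair c ((v - v0) / h))) with (fun v => W (s v)).
  assert (Hh : 0 < h) by (apply Rdiv_lt_0_compat; lra).
  assert (Hnh : v0 + INR n * h = v1) by (unfold h; field; lra).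
  assert (srange : forall v, closed_itv v0 v1 v -> closed_itv v0 v1 (s v)).
  { intros v Hv. unfold closed_itv in *. rewrite <- Hnh in *.
    apply staircase_param_range; assumption. }
  assert (Winc : forall y z, v0 <= y -> y <= z -> z <= v1 -> W y <= W z).
  { apply (derive_nonneg_nondecreasing v0 v1 W (fun v => c * f (W v))).
    - intros x Hx. apply HW, Hx.
    - intros x Hx. destruct (HW x) as [P _]; [unfold closed_itv; lra|].
      apply Rmult_le_pos; lra. }
  assert (sinc : forall y z, y <= z -> s y <= s z).
  { intros y z Hyz. unfold s.
    assert (Hd : (y - v0) / h <= (z - v0) / h)
      by (apply Rmult_le_compat_r; [left; apply Rinv_0_lt_compat|]; lra).
    destruct (stair_increment c _ _ Hc Hd) as [Hs _].
    pose proof (Rmult_le_compat_l h (stair c ((y - v0) / h)) (stair c ((z - v0) / h))).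
    lra. }
  split; [split|split; [|split; [|split]]].
  - apply continuous_on_forall. intros v Hv.
    apply (continuous_comp s W).
    + apply continuity_pt_filterlim. unfold s.
      apply continuity_pt_plus; [apply continuity_pt_const; intros ? ?; reflexivity|].
      apply (continuity_pt_scal (fun v => stair c ((v - v0) / h))).
      apply (continuity_pt_comp (fun v => (v - v0) / h) (stair c)).
      * apply (is_derive_continuity_pt _ _ (/ h)). auto_derive; [lra|field; lra].
      * apply stair_continuity_pt, Hc.
    + apply (ex_derive_continuous (K := R_AbsRing) (V := R_NormedModule)).
      exists (c * f (W (s v))). apply HW, srange, Hv.
  - exists (2 * n)%nat, (fun j => v0 + h * knot c j).
    assert (knot_inc : forall i j, (i <= j)%nat -> knot c i <= knot c j).
    { intros i j Hij. induction Hij as [|j Hij IH]; [lra|].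
      pose proof (stair_affine_between_knots c j Hc) as [Hlt _]. lra. }
    split; [unfold knot; simpl; ring|].
    split; [rewrite knot_even, <- Hnh; ring|].
    intros j Hj.
    destruct (stair_affine_between_knots c j Hc) as [Hlt [al [be Haff]]].
    pose proof (Rmult_lt_compat_l h _ _ Hh Hlt) as Hlt'.
    split; [lra|].
    pose proof (Rmult_le_compat_l h _ _ ltac:(lra) (knot_inc 0%nat j ltac:(lia))) as H0.
    pose proof (Rmult_le_compat_l h _ _ ltac:(lra) (knot_inc (S j) (2 * n)%nat ltac:(lia))) as H1.
    rewrite knot_even in H1. replace (knot c 0) with 0 in H0 by (unfold knot; simpl; ring).
    set (A := v0 + h * al - be * v0).
    assert (saff : forall v, closed_itv (v0 + h * knot c j) (v0 + h * knot c (S j)) v ->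
      s v = A + be * v /\ closed_itv v0 v1 (A + be * v)).
    { intros v Hv. unfold closed_itv in Hv.
      assert (E : s v = A + be * v).
      { unfold s, A. rewrite Haff; [field; lra|].
        split; [apply Rle_div_r|apply Rle_div_l]; lra. }
      split; [exact E|]. rewrite <- E. apply srange. unfold closed_itv. lra. }
    assert (D : forall v, closed_itv (v0 + h * knot c j) (v0 + h * knot c (S j)) v ->
      is_derive (fun y => W (A + be * y)) v (be * (c * f (W (A + be * v))))).
    { intros v Hv.
      apply (is_derive_comp W (fun y => A + be * y)).
      - apply HW, saff, Hv.
      - auto_derive; [exact I|ring]. }
    exists (fun v => be * (c * f (W (A + be * v)))). split.
    + intros v Hv. apply (is_derive_D_in (fun y => W (A + be * y)));
        [exact Hv| |exact (D v Hv)].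
      intros y Hy. destruct (saff y Hy) as [-> _]. reflexivity.
    + apply continuous_on_forall. intros v Hv.
      apply (ex_derive_continuous (K := R_AbsRing) (V := R_NormedModule)).
      apply (ex_derive_scal (fun v => c * f (W (A + be * v))) be).
      apply (ex_derive_scal (fun v => f (W (A + be * v))) c).
      apply (ex_derive_comp f (fun v => W (A + be * v))).
      * apply HW, saff, Hv.
      * eexists. apply D, Hv.
  - intros v Hv. apply Wpos, srange, Hv.
  - intros v Hv. apply (nondecreasing_Derive_nonneg v0 v1); [exact Hv|].
    intros y z Hy Hyz Hz. apply Winc.
    + apply srange. unfold closed_itv; lra.
    + apply sinc, Hyz.
    + apply srange. unfold closed_itv; lra.
  - f_equal. unfold s. replace ((v0 - v0) / h) with 0 by (field; lra).
    rewrite stair_IZR by exact Hc. ring.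
  - f_equal. unfold s. replace ((v1 - v0) / h) with (INR n) by (rewrite <- Hnh; field; lra).
    rewrite INR_IZR_INZ, stair_IZR, <- INR_IZR_INZ by exact Hc. lra.
Qed.

(** The staircase stays within one cell length of the diagonal and [W] is
    uniformly continuous. *)
Lemma staircase_curve_near (W : R -> R) (c v0 v1 eps : R) :
  v0 < v1 -> 0 < c < 1 -> 0 < eps ->
  (forall v, closed_itv v0 v1 v -> continuity_pt W v) ->
  exists n : nat, (0 < n)%nat /\
    forall v, closed_itv v0 v1 v -> Rabs (staircase_curve c W v0 v1 n v - W v) < eps.
Proof.
  intros v01 Hc Heps HW.
  destruct (Heine W _ (compact_P3 v0 v1) HW (mkposreal eps Heps)) as [d Hd].
  destruct (archimed_cor1 (d / (v1 - v0))) as [n [Hn Hn0]].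
  { apply Rdiv_lt_0_compat; [apply cond_pos|lra]. }
  exists n; split; [exact Hn0|]. intros v Hv.
  apply lt_0_INR in Hn0. unfold staircase_curve. set (h := (v1 - v0) / INR n).
  assert (Hh : 0 < h) by (apply Rdiv_lt_0_compat; lra).
  assert (Hnh : v0 + INR n * h = v1) by (unfold h; field; lra).
  assert (Hhd : h < d).
  { apply (Rmult_lt_compat_r (v1 - v0)) in Hn; [|lra].
    replace (d / (v1 - v0) * (v1 - v0)) with (pos d) in Hn by (field; lra).
    unfold h, Rdiv. lra. }
  apply Hd; [| exact Hv |].
  - rewrite <- Hnh. apply staircase_param_range; [exact Hc|exact Hh|].
    rewrite Hnh. exact Hv.
  - replace (v0 + h * stair c ((v - v0) / h) - v) with
      (h * (stair c ((v - v0) / h) - (v - v0) / h)) by (field; lra).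
    rewrite Rabs_mult, (Rabs_pos_eq h) by lra.
    pose proof (Rmult_le_compat_l h _ _ ltac:(lra) (stair_near c ((v - v0) / h) Hc)).
    lra.
Qed.

(** * Comparison *)

Theorem theorem5p3 (a b : Rbar) (f : R -> R)
  (f_pos : forall x, open_itv a b x -> 0 < f x)
  (f_smooth : smooth_open (open_itv a b) f)
  (u0 u1 v0 v1 : R)
  (u0_pos : 0 < u0) (u0_lt_u1 : u0 < u1)
  (u01_sub : forall x, closed_itv u0 u1 x -> open_itv a b x)
  (v0_lt_v1 : v0 < v1)
  (u : R -> R)
  (u_adm : admissible u0 u1 v0 v1 u)
  (u_ext : extremal f v0 v1 u)
  (u_slow : exists (v : R) (du : R -> R),
     closed_itv v0 v1 v /\ D_in u du (closed_itv v0 v1) v /\ du v < f (u v)) :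
  forall w : R -> R,
    admissible u0 u1 v0 v1 w -> extremal f v0 v1 w ->
    ~ strong_local_minimizer f u0 u1 v0 v1 w.
Proof.
  intros w w_adm w_ext [_ [eps [Heps Hmin]]].
  assert (Hf : forall x, closed_itv u0 u1 x -> 0 < f x /\ ex_derive f x).
  { intros x Hx. split; [apply f_pos, u01_sub, Hx|].
    exact (f_smooth 1%nat x (u01_sub x Hx)). }
  assert (key : forall g, admissible u0 u1 v0 v1 g -> extremal f v0 v1 g ->
    exists (W : R -> R) (c : R), 0 < c /\
      c * (v1 - v0) = RInt (fun x => / f x) u0 u1 /\
      forall v, closed_itv v0 v1 v -> W v = g v /\
        (0 < f (W v) /\ ex_derive f (W v) /\ is_derive W v (c * f (W v))) /\
        D_in g (fun t => c * f (g t)) (closed_itv v0 v1) v).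
  { intros g g_adm g_ext.
    destruct (extremal_conformal_slope f u0 u1 v0 v1 g u0_lt_u1 v0_lt_v1 Hf g_adm g_ext)
      as [W [c [Hc HW]]].
    assert (HW' : constant_slope f c v0 v1 W).
    { intros v Hv. destruct (HW v Hv) as [-> [Hr [D _]]].
      destruct (Hf _ Hr). split; [|split]; assumption. }
    exists W, c. split; [exact Hc|]. split.
    - rewrite (conformal_slope_eq f W c v0 v1 v0_lt_v1 HW').
      destruct g_adm as [_ [_ [_ [Hg0 Hg1]]]].
      destruct (HW v0) as [-> _]; [unfold closed_itv; lra|].
      destruct (HW v1) as [-> _]; [unfold closed_itv; lra|].
      rewrite Hg0, Hg1. reflexivity.
    - intros v Hv. split; [apply HW, Hv|]. split; [apply HW', Hv|apply HW, Hv]. }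
  destruct (key u u_adm u_ext) as [Wu [cu [_ [Icu Hu]]]].
  destruct (key w w_adm w_ext) as [W [c [Hc [Ic HW]]]].
  assert (c = cu) as <-.
  { apply (Rmult_eq_reg_r (v1 - v0)); lra. }
  assert (c < 1) as Hc1.
  { destruct u_slow as [v [du [Hv [Du Hlt]]]].
    destruct (Hu v Hv) as [E [[P _] D]]. rewrite E in P.
    rewrite (D_in_unique _ _ _ _ _ v v0_lt_v1 Hv Du D) in Hlt.
    apply (Rmult_lt_reg_r (f (u v))); lra. }
  assert (Hcc : 0 < c < 1) by lra.
  assert (HW' : constant_slope f c v0 v1 W)
    by (intros v Hv; apply HW, Hv).
  destruct (staircase_curve_near W c v0 v1 (eps / 2) v0_lt_v1 Hcc ltac:(lra))
    as [n [Hn Hnear]].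
  { intros v Hv. eapply is_derive_continuity_pt, HW', Hv. }
  assert (Hw0 : W v0 = u0).
  { destruct (HW v0) as [-> _]; [unfold closed_itv; lra|]. apply w_adm. }
  assert (Hw1 : W v1 = u1).
  { destruct (HW v1) as [-> _]; [unfold closed_itv; lra|]. apply w_adm. }
  assert (Rz := staircase_curve_resistance f W c v0 v1 n v0_lt_v1 Hcc Hn HW').
  assert (Rw : resistance f v0 v1 w = (v1 - v0) / (1 + c ^ 2)).
  { apply is_RInt_unique.
    replace (1 + c ^ 2) with (1 + (c * 1) ^ 2) by ring.
    apply (is_RInt_affine_reparam f W w c 0 1); [lra|]. intros v Hv.
    replace (0 + 1 * v) with v by ring.
    assert (Hv' : closed_itv v0 v1 v) by (unfold closed_itv; lra).
    destruct (HW' v Hv') as [P [_ D]].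
    split; [symmetry; apply HW, Hv'|]. split; assumption. }
  assert (Hge : resistance f v0 v1 (staircase_curve c W v0 v1 n)
                >= resistance f v0 v1 w).
  { apply Hmin.
    - rewrite <- Hw0, <- Hw1.
      apply (staircase_curve_admissible f); try assumption.
      intros v Hv. destruct (HW v Hv) as [-> _]. apply w_adm, Hv.
    - apply Rbar_le_lt_trans with (Finite (eps / 2)); [|simpl; lra].
      apply (proj2 (Lub_Rbar_correct _)).
      intros y [v [Hv ->]]. simpl. destruct (HW v Hv) as [<- _].
      left. apply Hnear, Hv. }
  rewrite Rz, Rw in Hge.
  (* 1 / (1 + c ^ 2) - (1 - c / 2) = c (1 - c) ^ 2 / (2 (1 + c ^ 2)). *)
  assert (Hgap : 0 < (v1 - v0) * (c * (1 - c) ^ 2 / (2 * (1 + c ^ 2)))).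
  { pose proof (pow2_ge_0 c).
    apply Rmult_lt_0_compat; [lra|]. apply Rdiv_lt_0_compat; [|lra].
    apply Rmult_lt_0_compat; [lra|]. apply pow_lt; lra. }
  replace ((v1 - v0) * (c * (1 - c) ^ 2 / (2 * (1 + c ^ 2)))) with
    ((v1 - v0) / (1 + c ^ 2) - (v1 - v0) * (1 - c / 2)) in Hgap.
  - lra.
  - pose proof (pow2_ge_0 c). field. lra.
Qed.
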